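(* Let $p$ be a prime number, let $k \geq 0$ be an integer, let $0 \leq n_0 < n_1 < \ldots < n_k < p$ be integers, and let $c_0, \ldots, c_k$ be non-zero complex numbers. Then the polynomial $\sum_{j=0}^k c_j z^{n_j}$, when restricted to the set of $p$-th roots of unity $\{z \in \mathbb{C} : z^p = 1\}$, has at most $k$ zeroes; that is, there are at most $k$ distinct complex numbers $z$ with $z^p = 1$ and $\sum_{j=0}^k c_j z^{n_j} = 0$. *)

(* Defs.v *)
From HB Require Import structures.
From mathcomp Require Import all_boot all_order all_algebra.
From mathcomp Require Import boolp classical_sets functions cardinality reals.
From mathcomp Require Import complex.

Set Implicit Arguments.
Unset Strict Implicit.
Unset Printing Implicit Defensive.

(* Main.v *)
Require Import Defs.
From HB Require Import structures.
From mathcomp Require Import all_boot all_order all_algebra.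
From mathcomp Require Import boolp classical_sets functions cardinality reals.
From mathcomp Require Import complex.
From mathcomp Require Import finmap.

Set Implicit Arguments.
Unset Strict Implicit.
Unset Printing Implicit Defensive.

Import Order.TTheory GRing.Theory Num.Theory.
Local Open Scope ring_scope.
Local Open Scope classical_set_scope.
Local Open Scope complex_scope.
Local Open Scope card_scope.

(** Suppose the polynomial vanishes at [k + 1] distinct [p]-th roots of unity
[z_i = w ^+ m_i]. Its divided differences at the nodes [z_0, ..., z_i] then
vanish too, so the matrix of divided differences of the monomials ['X^(n j)] is
singular. This matrix is the value at [w] of a matrix over [int[X]], in which
divided differences stay meaningful when the nodes collide. Its determinant [d]
satisfies [d(w) = 0], hence [p] divides [d(1)]. At [1] all nodes equal [1], so
over [F_p] some nonzero combination of the [k + 1] monomials is divisible by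
[(X - 1) ^+ k.+1], which is impossible since the exponents are distinct
modulo [p]. *)

Import Pdiv.Ring Pdiv.RingMonic.

Section IteratedQuotient.
Variable A : comNzRingType.
Implicit Types (x : nat -> A) (f g : {poly A}).

Lemma rdivp_XsubC_eq a q r f :
  f = q * ('X - a%:P) + r%:P -> rdivp f ('X - a%:P) = q.
Proof.
move=> ->; apply: rdivp_addl_mul_small; first exact: monicXsubC.
by rewrite size_XsubC (leq_ltn_trans (size_polyC_leq1 _)).
Qed.

Lemma rdivp_XsubC a f : f = rdivp f ('X - a%:P) * ('X - a%:P) + (f.[a])%:P.
Proof.
have /factor_theorem[q fq] : root (f - (f.[a])%:P) a.
  by rewrite rootE hornerD hornerN hornerC subrr.
have {}fq : f = q * ('X - a%:P) + (f.[a])%:P by rewrite -fq subrK.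
by rewrite (rdivp_XsubC_eq fq).
Qed.

(* [(iterquo x i f).[x i]] is the divided difference [f[x 0, ..., x i]]; unlike
   the usual quotient of differences it makes sense for coinciding nodes. *)
Fixpoint iterquo x i f : {poly A} :=
  if i is j.+1 then rdivp (iterquo x j f) ('X - (x j)%:P) else f.

Lemma iterquo_is_linear x i a f g :
  iterquo x i (a *: f + g) = a *: iterquo x i f + iterquo x i g.
Proof.
elim: i => //= i ->; set q := iterquo x i f; set r := iterquo x i g.
apply: (@rdivp_XsubC_eq _ _ (a * q.[x i] + r.[x i])).
rewrite {1}(rdivp_XsubC (x i) q) {1}(rdivp_XsubC (x i) r).
by rewrite polyCD polyCM mul_polyC scalerDr mulrDl -scalerAl scale_polyC -!mul_polyC polyCM !addrA;
  congr (_ + _); rewrite addrAC.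
Qed.

Lemma iterquo_sum x i m (a : 'I_m -> A) (f : 'I_m -> {poly A}) :
  iterquo x i (\sum_j a j *: f j) = \sum_j a j *: iterquo x i (f j).
Proof.
have iter0 : iterquo x i 0 = 0.
  by have := iterquo_is_linear x i (-1) 0 0; rewrite scaleN1r addr0 oppr0 scaleN1r addNr.
elim/big_rec2: _ => // j g h _ <-; exact: iterquo_is_linear.
Qed.

(** Newton's interpolation formula: the values [(iterquo x i f).[x i]] are its coefficients, and
    once they vanish only the remainder term survives. *)
Lemma iterquo_factor x k f :
  (forall i, (i < k)%N -> (iterquo x i f).[x i] = 0) ->
  f = iterquo x k f * \prod_(i < k) ('X - (x i)%:P).
Proof.
elim: k => [|k IHk] fx /=; first by rewrite big_ord0 mulr1.
rewrite big_ord_recr /= mulrCA mulrC [_ * ('X - _)](_ : _ = iterquo x k f).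
  by rewrite -IHk // => i ik; apply: fx; apply: ltnW.
by rewrite {2}(rdivp_XsubC (x k) (iterquo x k f)) fx // addr0.
Qed.

End IteratedQuotient.

(** Division by a monic polynomial commutes with ring morphisms; this lets one matrix over
    [{poly int}] be read both at [w] and at 1 modulo [p]. *)
Lemma map_iterquo (A B : comNzRingType) (h : {rmorphism A -> B}) (x : nat -> A)
    i (f : {poly A}) :
  map_poly h (iterquo x i f) = iterquo (h \o x) i (map_poly h f).
Proof.
elim: i => //= i <-; set q := iterquo x i f; apply/esym.
apply: (@rdivp_XsubC_eq _ _ _ (h q.[x i])).
rewrite {1}(rdivp_XsubC (x i) q) rmorphD rmorphM /= rmorphB /= map_polyX.
by rewrite !map_polyC.
Qed.

(** By induction the Newton form of [f] reduces to its remainder term, whose nodal product is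
    nonzero at [x i] because the nodes are distinct. *)
Lemma iterquo_roots (F : idomainType) (x : nat -> F) k (f : {poly F}) :
    {in gtn k &, injective x} -> (forall i, (i < k)%N -> f.[x i] = 0) ->
  forall i, (i < k)%N -> (iterquo x i f).[x i] = 0.
Proof.
move=> inj_x fx i; elim/ltn_ind: i => i IHi ik.
have /eqP := fx i ik.
rewrite {1}(@iterquo_factor _ x i f) => [|l li]; last first.
  by apply: IHi => //; apply: ltn_trans ik.
rewrite hornerM mulf_eq0 => /orP[/eqP // |].
rewrite horner_prod => /prodf_eq0 [l _]; rewrite hornerXsubC subr_eq0.
have lk : (l < k)%N by apply: ltn_trans ik.
by move/eqP/inj_x => /(_ ik lk) il; have := ltn_ord l; rewrite -il ltnn.
Qed.

Section SparseMultiplicity.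
Variable K : fieldType.

Lemma dvdp_theta k (f : {poly K}) :
  ('X - 1) ^+ k.+1 %| f -> ('X - 1) ^+ k %| 'X * f^`().
Proof.
case/dvdpP=> q ->; rewrite derivM deriv_exp /= dvdp_mull // dvdp_add //.
  by rewrite exprS !dvdp_mull.
by rewrite -mulrnAl !dvdp_mull.
Qed.

(* Induction on the number of terms: [theta - n k], with [theta = X d/dX], kills
   the last term and lowers the multiplicity at 1 by at most one. *)
Lemma sparse_multiplicity k (c : nat -> K) (n : nat -> nat) :
    {in gtn k &, injective (fun j => (n j)%:R : K)} ->
    ('X - 1) ^+ k %| \sum_(j < k) c j *: 'X^(n j) ->
  forall j, (j < k)%N -> c j = 0.
Proof.
elim: k c => [|k IHk] c // inj_n dvd_f.
have inj_n' : {in gtn k &, injective (fun j => (n j)%:R : K)}.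
  by move=> i j ik jk; apply: inj_n; apply: ltnW.
have c0 j : (j < k)%N -> c j = 0.
  move=> jk; have := IHk (fun j => ((n j)%:R - (n k)%:R) * c j) inj_n' _ j jk.
  have /[swap]/[apply] : ('X - 1) ^+ k %|
      \sum_(i < k) (((n i)%:R - (n k)%:R) * c i) *: 'X^(n i).
    have thetaX m : 'X * ('X^m)^`() = m%:R *: 'X^m :> {poly K}.
      by case: m => [|m]; rewrite derivXn ?mulr0 ?scale0r // mulrnAr -exprS scaler_nat.
    have := dvdp_sub (dvdp_theta dvd_f) (dvdp_trans (dvdp_exp2l ('X - 1) (leqnSn k))
      (dvdp_trans dvd_f (dvdp_mulIr (n k)%:R%:P _))).
    rewrite !mulr_sumr; congr (_ %| _).
    rewrite raddf_sum mulr_sumr -sumrB big_ord_recr /= derivZ -scalerAr thetaX.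
    rewrite mul_polyC !scalerA mulrC subrr addr0; apply: eq_bigr => i _.
    by rewrite derivZ -scalerAr thetaX mul_polyC !scalerA -scalerBl mulrBl mulrC.
  move/eqP; rewrite mulf_eq0 subr_eq0 => /orP[/eqP/inj_n|/eqP //].
  move=> /(_ (ltnW jk) (ltnSn k)) jk'; by rewrite jk' ltnn in jk.
move=> j; rewrite ltnS leq_eqVlt => /orP[/eqP ->|/c0 //].
(* With the other terms gone, evaluation at 1 isolates [c k]. *)
move: dvd_f; rewrite big_ord_recr big1 /= => [|i _]; last by rewrite c0 ?scale0r.
rewrite add0r -mul_polyC => /(dvdp_trans (dvdp_exp2l _ (ltn0Sn k))).
rewrite expr1 -[1]/(1%:P) dvdp_XsubCl rootE hornerM hornerC hornerXn expr1n mulr1.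
by move/eqP.
Qed.

End SparseMultiplicity.

(* The residues of [d * X^j] modulo [X^p - 1] have an integer coefficient matrix
   whose kernel over [F] contains [(w^i)_i], so this matrix is singular modulo
   [p]; a left kernel vector there is some [g] of degree [< p] with
   [(X - 1)^p = X^p - 1 %| d * g]. *)
Lemma dvdp_horner1_unity_root (F : numDomainType) (p : nat) (w : F) (d : {poly int}) :
    prime p -> w ^+ p = 1 -> (map_poly intr d).[w] = 0 ->
  (d.[1])%:~R = 0 :> 'F_p.
Proof.
move=> p_prime wp1 dw0; have p_gt0 := prime_gt0 p_prime.
pose u : {poly int} := 'X^p - 1.
have u_monic : u \is monic by apply: monicXnsubC.
pose r j := rmodp (d * 'X^j) u.
have size_r j : (size (r j) <= p)%N.
  by rewrite -ltnS -(size_XnsubC (1 : int) p_gt0) ltn_rmodp monic_neq0.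
have r_eq j : d * 'X^j = rdivp (d * 'X^j) u * u + r j by apply: rdivp_eq.
pose N : 'M[int]_p := \matrix_(j, i) (r j)`_i.
have map_u (B : nzRingType) (h : {rmorphism int -> B}) :
    map_poly h u = 'X^p - 1.
  by rewrite rmorphB /= map_polyXn rmorph1.
have detN : \det N = 0.
  apply/eqP; rewrite -(intr_eq0 F) -det_map_mx -det_tr; apply/det0P.
  exists (\row_i w ^+ i).
    apply/eqP => /rowP/(_ (Ordinal p_gt0)); rewrite !mxE expr0 => /eqP.
    by rewrite oner_eq0.
  apply/rowP => j; rewrite !mxE.
  have /(congr1 (fun q => (map_poly intr q).[w])) := r_eq j.
  rewrite !rmorphM rmorphD rmorphM /= map_u hornerM dw0 mul0r hornerD hornerM.
  rewrite !hornerE wp1 subrr mulr0 add0r => r0.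
  transitivity (map_poly intr (r j)).[w]; last by rewrite -r0.
  rewrite (@horner_coef_wide _ p) ?(leq_trans (size_poly _ _)) //.
  by apply: eq_bigr => i _; rewrite !mxE coef_map mulrC.
have /det0P[v v_neq0 vN] : \det (map_mx (intr : int -> 'F_p) N) == 0.
  by rewrite det_map_mx detN.
pose toF := map_poly (intr : int -> 'F_p).
pose g := \sum_j v 0 j *: 'X^j.
have size_g : (size g <= p)%N.
  apply: (leq_trans (size_sum _ _ _)); apply/bigmax_leqP => j _.
  by rewrite (leq_trans (size_scale_leq _ _)) // size_polyXn.
have dvd_dg : ('X - 1) ^+ p %| toF d * g.
  have -> : ('X - 1) ^+ p = 'X^p - 1 :> {poly 'F_p}.
    have pcharP : p \in [pchar {poly 'F_p}].
      by rewrite (rmorph_pchar (polyC : {rmorphism 'F_p -> _})) ?pchar_Fp.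
    by rewrite -!(pFrobenius_autE pcharP) rmorphB rmorph1.
  have -> : toF d * g =
      (\sum_j v 0 j *: toF (rdivp (d * 'X^j) u)) * ('X^p - 1) +
      \sum_j v 0 j *: toF (r j).
    rewrite mulr_suml -big_split mulr_sumr; apply: eq_bigr => j _ /=.
    rewrite -scalerAr -scalerAl -scalerDr -(map_u _ intr) -rmorphM -rmorphD -r_eq.
    by rewrite rmorphM /= map_polyXn.
  suff -> : \sum_j v 0 j *: toF (r j) = 0 by rewrite addr0 dvdp_mull.
  apply/polyP => i; rewrite coef_sum coef0.
  have [ip|pi] := ltnP i p; last first.
    by rewrite big1 // => j _; rewrite coefZ coef_map (leq_sizeP _ _ (size_r j)) ?mulr0.
  have /rowP/(_ (Ordinal ip)) := vN; rewrite !mxE => vNi.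
  rewrite -[RHS]vNi.
  by apply: eq_bigr => j _; rewrite !mxE coefZ coef_map.
apply: contra_neq_eq v_neq0 => d1.
(* If [d] is nonzero at 1 modulo [p], the whole power of ['X - 1] must divide [g], whose degree is
   below [p]. *)
have cop : coprimep (('X - 1) ^+ p) (toF d).
  rewrite coprimep_expl // coprimep_sym -[1]/(1%:P) coprimep_XsubC rootE.
  by rewrite -[1](rmorph1 (intr : {rmorphism int -> 'F_p})) horner_map.
have g0 : g = 0.
  apply/eqP; apply: contraT => g_neq0.
  move: dvd_dg; rewrite Gauss_dvdpr // => /(dvdp_leq g_neq0).
  by rewrite -[1]/(1%:P) size_exp_XsubC ltnNge size_g.
apply/rowP => j; rewrite mxE.
have /(congr1 (fun q : {poly _} => q`_j)) := g0.
rewrite coef0 coef_sum (bigD1 j) //= coefZ coefXn eqxx mulr1 big1 ?addr0 // => i ij.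
by rewrite coefZ coefXn eq_sym (inj_eq val_inj) (negPf ij) mulr0.
Qed.

(** The order of each root divides the prime [p], so any element of [s] other than 1 is primitive
    and generates the rest; if there is none, [w = 1] works. *)
Lemma unity_roots_cyclic (F : fieldType) (p : nat) (s : seq F) :
    prime p -> (forall z, z \in s -> z ^+ p = 1) ->
  exists2 w : F, w ^+ p = 1 & forall z, z \in s -> exists m, z = w ^+ m.
Proof.
move=> p_prime s1; have [/hasP[w ws w1]|/hasPn s_eq1] := boolP (has (fun z => z != 1) s).
  have wp := s1 _ ws; exists w => // z /s1 zp.
  have [m prim_w /(primeP p_prime).2] := prim_order_exists (prime_gt0 p_prime) wp.
  case/orP=> /eqP mE; first by rewrite -(prim_expr_order prim_w) mE expr1 eqxx in w1.
  rewrite mE in prim_w; have [i ->] := prim_rootP prim_w zp.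
  by exists i.
exists 1 => [|z /s_eq1/negPn/eqP ->]; first by rewrite expr1n.
by exists 0.
Qed.

Lemma size_unity_roots_sparse (F : numFieldType) (p k : nat) (n : 'I_k.+1 -> nat)
    (c : 'I_k.+1 -> F) (s : seq F) :
    prime p -> injective n -> (forall j, (n j < p)%N) -> (exists j, c j != 0) ->
    uniq s ->
    (forall z, z \in s -> z ^+ p = 1 /\ (\sum_j c j *: 'X^(n j)).[z] = 0) ->
  (size s <= k)%N.
Proof.
move=> p_prime inj_n n_lt_p [j0 cj0] uniq_s s_root; rewrite leqNgt; apply/negP => ks.
have s_unity z : z \in s -> z ^+ p = 1 by move/s_root => [].
have [w wp ws] := unity_roots_cyclic p_prime s_unity.
have /boolp.choice[m mE] : forall i, exists l, (i < size s)%N -> s`_i = w ^+ l.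
  move=> i; have [si|_] := ltnP i (size s); last by exists 0%N.
  by have [l ->] := ws _ (mem_nth 0 si); exists l.
(* The nodes ['X^(m l)] become the given roots at [w] and all collide at 1. *)
pose D : 'M[{poly int}]_k.+1 := \matrix_(i, j)
  (iterquo (fun l => 'X^(m l)) i ('X^(n j))).['X^(m i)].
have mapD (B : comNzRingType) (h : {rmorphism {poly int} -> B}) (i j : 'I_k.+1) :
    h (D i j) = (iterquo (fun l => h 'X ^+ m l) i ('X^(n j))).[h 'X ^+ m i].
  rewrite mxE -horner_map /= map_iterquo map_polyXn rmorphXn /=.
  congr (_.[_]); elim: (nat_of_ord i) => //= l ->; by rewrite rmorphXn.
pose evw : {rmorphism {poly int} -> F} := horner_eval w \o map_poly intr.
pose ev1 : {rmorphism {poly int} -> 'F_p} := intr \o horner_eval 1.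
have evwX : evw 'X = w by rewrite /evw /= /horner_eval map_polyX hornerX.
have ev1X : ev1 'X = 1 by rewrite /ev1 /= /horner_eval hornerX.
have detDw : evw (\det D) = 0.
  (* Row [i] applied to [c] is the divided difference of the sparse polynomial at the first [i + 1]
     roots. *)
  apply/eqP; rewrite -det_map_mx -det_tr; apply/det0P; exists (\row_j c j).
    by apply/eqP => /rowP/(_ j0); rewrite !mxE => /eqP; rewrite (negPf cj0).
  apply/rowP => i; rewrite !mxE.
  pose x l := w ^+ m l.
  have xE l : (l < k.+1)%N -> x l = s`_l by move=> lk; rewrite mE ?(leq_trans lk).
  have : (iterquo x i (\sum_j c j *: 'X^(n j))).[x i] = 0.
    apply: (@iterquo_roots _ _ k.+1) => // [a b ak bk|l lk].
      rewrite !xE // => /eqP; rewrite nth_uniq ?(leq_trans ak) ?(leq_trans bk) //.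
      by move/eqP.
    by rewrite xE //; have [] := s_root _ (mem_nth 0 (leq_trans lk ks)).
  rewrite iterquo_sum horner_sum => x0; rewrite -[RHS]x0; apply: eq_bigr => j _.
  by have := mapD _ evw i j; rewrite hornerZ !mxE evwX => ->.
have detD1 : ev1 (\det D) = 0 by apply: (dvdp_horner1_unity_root p_prime wp detDw).
move/eqP: detD1; rewrite -det_map_mx -det_tr => /det0P[v v_neq0 vD].
pose f := \sum_(j < k.+1) v 0 j *: 'X^(n j).
(* The kernel equations say that the divided differences of [f] up to order [k], with all nodes
   equal to 1, vanish. *)
have f_eq : f = iterquo (fun=> 1) k.+1 f * ('X - 1) ^+ k.+1.
  rewrite {1}(@iterquo_factor _ (fun=> 1) k.+1 f) ?prodr_const ?card_ord // => i ik.
  have /rowP/(_ (Ordinal ik)) := vD; rewrite !mxE => vi; rewrite -[RHS]vi.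
  rewrite iterquo_sum horner_sum; apply: eq_bigr => j _.
  rewrite hornerZ !mxE; congr (_ * _); have := mapD _ ev1 (Ordinal ik) j.
  rewrite ev1X !mxE => ->; rewrite expr1n; congr (_.[_]) => /=.
  by elim: i {ik vi} => //= l ->; rewrite expr1n.
have dvd_f : ('X - 1) ^+ k.+1 %| \sum_(j < k.+1) v 0 (inord j) *: 'X^(n (inord j)).
  under eq_bigr do rewrite inord_val.
  by rewrite -/f f_eq dvdp_mulIr.
(* Distinct exponents below [p] stay distinct modulo [p]. *)
have inj_np : {in gtn k.+1 &, injective (fun j => (n (inord j))%:R : 'F_p)}.
  move=> a b ak bk /(congr1 val) /=; rewrite !val_Fp_nat // !modn_small // => /inj_n.
  by move/(congr1 val); rewrite /= !inordK.
have v0 := @sparse_multiplicity _ _ (fun j => v 0 (inord j)) _ inj_np dvd_f.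
case/eqP: v_neq0.
by apply/rowP => j; rewrite -[j]inord_val v0 ?mxE.
Qed.

(* MathComp world: the complex numbers are R[i] over the real numbers R;
   `I_k is the set of the k natural numbers below k. *)
Theorem mainTheorem2 (R : realType) (p : nat) (hp : prime p) (k : nat)
    (n : 'I_k.+1 -> nat)
    (hn : forall i j : 'I_k.+1, (i < j)%N -> (n i < n j)%N)
    (hnp : forall j : 'I_k.+1, (n j < p)%N)
    (c : 'I_k.+1 -> R[i]) (hc : forall j : 'I_k.+1, c j != 0) :
  [set z : R[i] | z ^+ p = 1 /\ (\sum_(j < k.+1) c j *: 'X^(n j)).[z] = 0]
    #<= `I_k.
Proof.
set A := [set z | _].
have inj_n : injective n.
  move=> i j nij; apply: val_inj; case: (ltngtP i j) => // /hn; rewrite nij ltnn //.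
have c_neq0 : exists j, c j != 0 by exists ord0.
have sizeA (X : {fset R[i]}) : [set` X] `<=` A -> (#|` X| <= k)%N.
  by move=> XA; apply: (size_unity_roots_sparse hp inj_n hnp c_neq0 (fset_uniq X)).
(* An infinite zero set would contain a finite set of more than [k] zeros, which [sizeA] forbids. *)
have [/finite_fsetP[X AX]|/(infinite_set_fset k.+1)[X /sizeA]] := pselect (finite_set A).
  rewrite AX (card_le_eql (introT card_eq_fsetP (erefl #|` X|))).
  by rewrite card_le_II sizeA ?AX.
by rewrite leqNgt => /negP.
Qed.
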